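(* Let $\varphi:\mathbb{R}\to\mathbb{R}$ be a polynomial (with real coefficients) of degree greater than or equal to two, and let $C_\varphi:\mathcal{S}(\mathbb{R})\to\mathcal{S}(\mathbb{R})$, $f\mapsto f\circ\varphi$. Then the following are equivalent: (1) $C_\varphi$ is power bounded. (2) $C_\varphi$ is mean ergodic. (3) The degree of $\varphi$ is even and $\varphi$ has no fixed points (in $\mathbb{R}$).
   Context: $\mathcal{S}(\mathbb{R})$ is the Schwartz space of smooth rapidly decreasing functions $f:\mathbb{R}\to\mathbb{C}$ with its usual Fréchet topology, given by the seminorms $\pi_n(f)=\sup_{x\in\mathbb{R}}\sup_{0\le j\le n}(1+|x|^2)^n|f^{(j)}(x)|$, $n\in\mathbb{N}$. A continuous linear operator $T:X\to X$ on a locally convex space is power bounded if $\{T^n:n\in\mathbb{N}\}$ is equicontinuous. It is mean ergodic if the Cesàro means $T_{[n]}=\frac1n\sum_{k=1}^nT^k$ converge to a continuous linear operator $P$ in the strong operator topology, i.e. $T_{[n]}(x)\to P(x)$ for each $x\in X$. *)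

(* Defs.v *)
From HB Require Import structures.
From mathcomp Require Import all_boot all_order all_algebra.
From mathcomp Require Import complex ring lra.
From mathcomp Require Import all_classical all_reals all_analysis.
Set Implicit Arguments.
Unset Strict Implicit.
Unset Printing Implicit Defensive.
Import Order.TTheory GRing.Theory Num.Theory.
Import numFieldNormedType.Exports.
Local Open Scope classical_set_scope.
Local Open Scope ring_scope.

Section MeanErgodic.
Variables (K : numFieldType) (X : tvsType K).

(* Equicontinuity of {T^n : n \in nat}, spelled out because equicontinuous
   requires a pointed codomain, which a tvsType does not provide; see
   schwartz_power_boundedE below. *)
Definition power_bounded (T : {linear X -> X}) :=
  forall x (E : set (X * X)), entourage E ->
    \forall y \near x, forall n, E (iter n T x, iter n T y).

Definition cesaro_mean (T : {linear X -> X}) (n : nat) (x : X) : X :=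
  n%:R^-1 *: \sum_(1 <= k < n.+1) iter k T x.

Definition mean_ergodic (T : {linear X -> X}) :=
  exists2 P : {linear X -> X}, continuous P &
    forall x, cesaro_mean T n x @[n --> \oo] --> P x.

End MeanErgodic.

Section RcomplexNormedModule.
Variable R : realType.

HB.instance Definition _ :=
  PseudoMetric.copy (Rcomplex R) (pseudoMetric_normed (Rcomplex R)).
HB.instance Definition _ := isPointed.Build (Rcomplex R) 0.
HB.instance Definition _ := NormedZmod_PseudoMetric_eq.Build R (Rcomplex R) erefl.

Lemma Rcomplex_normrZ (l : R) (x : Rcomplex R) : `|l *: x| = `|l| * `|x|.
Proof.
case: x => a b; rewrite /Num.norm/= /ComplexField.Normc.normc /=.
by rewrite !exprMn -mulrDr sqrtrM ?sqr_ge0 // sqrtr_sqr.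
Qed.

HB.instance Definition _ :=
  PseudoMetricNormedZmod_Lmodule_isNormedModule.Build R (Rcomplex R)
    Rcomplex_normrZ.

Lemma Rcomplex_normrM (x y : R[i]) :
  `|x * y : Rcomplex R| = `|x : Rcomplex R| * `|y : Rcomplex R|.
Proof. exact: ComplexField.Normc.normcM. Qed.

Lemma Rcomplex_normE (x : R[i]) : `|x| = (real_complex _ `|x : Rcomplex R|).
Proof. by []. Qed.

End RcomplexNormedModule.

Section ComplexDerivative.
Variable R : realType.
Implicit Types (g : R -> Rcomplex R) (x : R).

Lemma derive1_val g x l : is_derive x 1 g l -> derive1 g x = l.
Proof. by move=> [_ <-]; exact: derive1E. Qed.

Lemma is_derive1_cmul (a : R[i]) g x (l : Rcomplex R) :
  is_derive x 1 g l -> is_derive x 1 (fun y => a * g y : Rcomplex R) (a * l).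
Proof.
move=> [dg dgl].
pose q (k : R -> Rcomplex R) := fun h : R => h^-1 *: ((k \o shift x) (h *: 1) - k x).
have qg : q g @ 0^' --> l by rewrite -dgl; exact: dg.
have mulZ (r : R) (z : Rcomplex R) : r *: (a * z : Rcomplex R) = a * (r *: z) :> Rcomplex R.
  by case: a z => a1 a2 [z1 z2]; congr Complex; ring.
have qag : q (fun y => a * g y : Rcomplex R) = (fun h => a * q g h : Rcomplex R).
  by apply/funext => h; rewrite /q /= -mulZ; congr (_ *: _); rewrite mulrBr.
have cv : q (fun y => a * g y : Rcomplex R) @ 0^' --> (a * l : Rcomplex R).
  rewrite qag; apply/cvgrPdist_lt => e e0.
  have a0 : 0 < `|a : Rcomplex R| + 1 by rewrite ltr_wpDl.
  have /cvgrPdist_lt /(_ (e / (`|a : Rcomplex R| + 1)) (divr_gt0 e0 a0)) := qg.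
  apply: filterS => h; rewrite -[_ - _ in X in _ -> X](mulrBr a) Rcomplex_normrM.
  rewrite ltr_pdivlMr// => H; apply: le_lt_trans H.
  by rewrite mulrC ler_wpM2l// lerDl.
split; first by apply/cvg_ex; exists (a * l : Rcomplex R); exact: cv.
exact: cvg_lim cv.
Qed.

Lemma is_derive1_chain g (p : R -> R) x l d :
  is_derive (p x) 1 g l -> is_derive x 1 p d -> is_derive x 1 (g \o p) (d *: l).
Proof.
move=> [/derivable1_diffP dg <-] [/derivable1_diffP dp <-].
have dgp := differentiable_comp dp dg.
split; first exact/derivable1_diffP.
rewrite !deriveE// diff_comp//=.
rewrite -[X in 'd g (p x) X]mulr1 -[X in 'd g (p x) X]/(_ *: (1 : R)).
by rewrite linearZ.
Qed.

Lemma is_derive1_scale (u : R -> R) g x (du : R) (dg : Rcomplex R) :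
  is_derive x 1 u du -> is_derive x 1 g dg ->
  is_derive x 1 (fun y => u y *: g y) (du *: g x + u x *: dg).
Proof.
move=> [du1 du2] [dg1 dg2].
have uc : {for x, continuous u} by exact/differentiable_continuous/derivable1_diffP.
have cs : (shift x) (h *: (1 : R)) @[h --> (0 : R)^'] --> x.
  rewrite -[X in _ --> X]add0r; apply: cvgD; last exact: cvg_cst.
  under eq_fun do rewrite [_ *: _]mulr1.
  exact: cvg_within.
have cu : u (shift x (h *: (1 : R))) @[h --> (0 : R)^'] --> u x.
  exact: (continuous_cvg _ uc cs).
have cv : h^-1 *: (((fun y => u y *: g y) \o shift x) (h *: (1 : R)) - u x *: g x)
    @[h --> (0 : R)^'] --> du *: g x + u x *: dg.
  rewrite [X in X @ _ --> _](_ : _ = fun h : R =>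
    (h^-1 *: ((u \o shift x) (h *: (1 : R)) - u x)) *: g x +
    u (shift x (h *: (1 : R))) *: (h^-1 *: ((g \o shift x) (h *: (1 : R)) - g x))).
    apply: cvgD.
      by apply: cvgZ; [rewrite -du2; exact: du1|exact: cvg_cst].
    by apply: cvgZ => //; rewrite -dg2; exact: dg1.
  apply/funext => h /=.
  rewrite [_ *: (u _ - _)]/(_ * _) -scalerA scalerBl !scalerBr !scalerA.
  by rewrite [u _ * h^-1]mulrC [RHS]addrC addrA subrK.
split; first by apply/cvg_ex; exists (du *: g x + u x *: dg); exact: cv.
exact: cvg_lim cv.
Qed.

End ComplexDerivative.

Section SchwartzFunctions.
Variable R : realType.
Implicit Types (f g : R -> R[i]) (n j : nat) (x : R).

(* Rcomplex R is R[i] seen as a normed space over R, so that this is the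
   derivative with respect to the real variable; its norm is the modulus, with
   values in R. *)
Definition cderive j f : R -> Rcomplex R := derive1n j (f : R -> Rcomplex R).

Definition smooth f := forall j x, derivable (cderive j f) x 1.

Definition weight n x : R := (1 + `|x| ^+ 2) ^+ n.

(* That is, all the seminorms below are finite; outside this class the real
   supremum defining them is meaningless. *)
Definition rapidly_decreasing f := forall n j,
  exists M, forall x, weight n x * `|cderive j f x| <= M.

Definition is_schwartz f := smooth f /\ rapidly_decreasing f.

Definition seminorm n f : R :=
  sup [set r | exists x, exists2 j, (j <= n)%N & r = weight n x * `|cderive j f x|].

Lemma weight_ge1 n x : 1 <= weight n x.
Proof. by rewrite exprn_ege1// lerDl sqr_ge0. Qed.

Lemma weight_ge0 n x : 0 <= weight n x.
Proof. by rewrite (le_trans _ (weight_ge1 _ _)). Qed.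

Lemma weight_mono n m x : (n <= m)%N -> weight n x <= weight m x.
Proof. by move=> nm; rewrite ler_weXn2l// lerDl sqr_ge0. Qed.

Lemma seminorm_le n f M :
  (forall x j, (j <= n)%N -> weight n x * `|cderive j f x| <= M) -> seminorm n f <= M.
Proof.
move=> H; apply: ge_sup; first by exists (weight n 0 * `|cderive 0 f 0|), 0, 0%N.
by move=> _ [x [j jn ->]]; exact: H.
Qed.

Lemma le_seminorm f n m j x : is_schwartz f -> (n <= m)%N -> (j <= m)%N ->
  weight n x * `|cderive j f x| <= seminorm m f.
Proof.
move=> [_ df] nm jm.
apply: (@le_trans _ _ (weight m x * `|cderive j f x|)).
  by rewrite ler_wpM2r// weight_mono.
apply: ub_le_sup; last by exists x, j.
have /choice[M HM] : forall j, exists M, forall x, weight m x * `|cderive j f x| <= M.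
  by move=> k; exact: df.
exists (\sum_(k < m.+1) `|M k|) => _ [y [k km ->]].
apply: (le_trans (HM k y)); apply: (le_trans (ler_norm _)).
by rewrite (bigD1 (Ordinal (km : (k < m.+1)%N)))//= lerDl sumr_ge0.
Qed.

Lemma seminorm_ge0 n f : is_schwartz f -> 0 <= seminorm n f.
Proof.
move=> sf; apply: le_trans (le_seminorm 0 sf (leqnn n) (leqnn n)).
by rewrite mulr_ge0// weight_ge0.
Qed.

Lemma seminorm_mono n m f : is_schwartz f -> (n <= m)%N -> seminorm n f <= seminorm m f.
Proof.
by move=> sf nm; apply: seminorm_le => x j jn; apply: le_seminorm => //; exact: leq_trans nm.
Qed.

End SchwartzFunctions.

Section SchwartzSubspace.
Variable R : realType.
Implicit Types (f g : R -> R[i]) (n j : nat) (x : R) (a : R[i]).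

Lemma cderiveS f j x : cderive j.+1 f x = derive1 (cderive j f) x.
Proof. by []. Qed.

Lemma is_derive_cderive f j x : smooth f -> is_derive x 1 (cderive j f) (cderive j.+1 f x).
Proof. by move=> sf; split; [exact: sf|rewrite cderiveS derive1E]. Qed.

Lemma cderive_uniq f (F : nat -> R -> Rcomplex R) : F 0%N = f ->
  (forall j x, is_derive x 1 (F j) (F j.+1 x)) ->
  smooth f /\ forall j, cderive j f = F j.
Proof.
move=> F0 dF; have E j : cderive j f = F j.
  elim: j => [|j IH]; first by rewrite F0.
  by apply/funext => x; rewrite cderiveS IH; apply: derive1_val.
by split=> // j x; rewrite E; have [] := dF j x.
Qed.

Lemma cderive_lin a f g : smooth f -> smooth g ->
  smooth (a *: f + g) /\
  forall j, cderive j (a *: f + g) = (fun x => a * cderive j f x + cderive j g x).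
Proof.
move=> sf sg; apply: cderive_uniq => // j x.
apply: (@is_deriveD _ _ _ (fun x => a * cderive j f x : Rcomplex R) (cderive j g)).
  exact/is_derive1_cmul/is_derive_cderive.
exact: is_derive_cderive.
Qed.

Lemma cderive0 : smooth (0 : R -> R[i]) /\
  forall j, cderive j (0 : R -> R[i]) = (fun=> 0).
Proof.
by apply: cderive_uniq => // j x; exact: is_derive_cst.
Qed.

Lemma seminorm_bound_lin a f g n : is_schwartz f -> is_schwartz g ->
  forall x j, (j <= n)%N -> weight n x * `|cderive j (a *: f + g) x|
   <= `|a : Rcomplex R| * seminorm n f + seminorm n g.
Proof.
move=> sf sg x j jn; have [_ ->] := cderive_lin a sf.1 sg.1.
apply: (@le_trans _ _ (`|a : Rcomplex R| * (weight n x * `|cderive j f x|) +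
   weight n x * `|cderive j g x|)).
  rewrite mulrCA -mulrDr ler_wpM2l ?weight_ge0//.
  by rewrite (le_trans (ler_normD _ _))// Rcomplex_normrM.
by rewrite lerD ?ler_wpM2l// le_seminorm.
Qed.

Lemma is_schwartz_lin a f g : is_schwartz f -> is_schwartz g ->
  is_schwartz (a *: f + g).
Proof.
move=> sf sg; split; first exact: (cderive_lin a sf.1 sg.1).1.
move=> n j; exists (`|a : Rcomplex R| * seminorm (maxn n j) f + seminorm (maxn n j) g) => x.
apply: le_trans (seminorm_bound_lin a sf sg x (leq_maxr n j)).
by rewrite ler_wpM2r// weight_mono// leq_maxl.
Qed.

Lemma is_schwartz0 : is_schwartz (0 : R -> R[i]).
Proof.
split; first exact: cderive0.1.
by move=> n j; exists 0 => x; rewrite cderive0.2 normr0 mulr0.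
Qed.

Definition schwartz_pred : {pred R -> R[i]} := [pred f | `[< is_schwartz f >]].

Lemma schwartz_predP f : reflect (is_schwartz f) (f \in schwartz_pred).
Proof. exact: asboolP. Qed.

Fact schwartz_submod_closed : submod_closed schwartz_pred.
Proof.
split; first exact/schwartz_predP/is_schwartz0.
by move=> a f g /schwartz_predP sf /schwartz_predP sg; exact/schwartz_predP/is_schwartz_lin.
Qed.

HB.instance Definition _ :=
  GRing.isSubmodClosed.Build R[i] (R -> R[i]) schwartz_pred schwartz_submod_closed.

Record schwartz := Schwartz {
  schwartz_val :> R -> R[i];
  _ : schwartz_val \in schwartz_pred }.

HB.instance Definition _ := [isSub for schwartz_val].
HB.instance Definition _ := [Choice of schwartz by <:].
HB.instance Definition _ := [SubChoice_isSubLmodule of schwartz by <:].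

Lemma schwartzP (f : schwartz) : is_schwartz f.
Proof. by case: f => f /= /schwartz_predP. Qed.

Lemma seminorm_lin n a (f g : schwartz) :
  seminorm n (a *: f + g : schwartz) <= `|a : Rcomplex R| * seminorm n f + seminorm n g.
Proof. by apply: seminorm_le; apply: seminorm_bound_lin; exact: schwartzP. Qed.

Lemma seminormD n (f g : schwartz) :
  seminorm n (f + g : schwartz) <= seminorm n f + seminorm n g.
Proof.
have := seminorm_lin n 1 f g.
by rewrite scale1r [`|_|]ComplexField.Normc.normc1 mul1r.
Qed.

Lemma seminorm0 n : seminorm n (0 : schwartz) = 0.
Proof.
apply/eqP; rewrite eq_le seminorm_ge0 ?andbT; last exact: schwartzP.
by apply: seminorm_le => x j _; rewrite cderive0.2 normr0 mulr0.
Qed.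

Lemma seminormZ n a (f : schwartz) :
  seminorm n (a *: f : schwartz) <= `|a : Rcomplex R| * seminorm n f.
Proof. by have := seminorm_lin n a f 0; rewrite !addr0 seminorm0 addr0. Qed.

Lemma seminormN n (f : schwartz) : seminorm n (- f : schwartz) = seminorm n f.
Proof.
suff H h : seminorm n (- h : schwartz) <= seminorm n h.
  by apply/eqP; rewrite eq_le H/= -[X in X <= _]/(seminorm n f) -{1}[f]opprK H.
have := seminormZ n (-1) h.
by rewrite scaleN1r normrN [`|_|]ComplexField.Normc.normc1 mul1r.
Qed.

End SchwartzSubspace.

Section SchwartzTopology.
Variable R : realType.
Local Notation S := (schwartz R).
Implicit Types (f g h : S) (n : nat).

(* As the seminorms increase with n, the sets of pairs at small distance for a
   single seminorm already form a basis of the uniformity generated by all of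
   them. *)
Definition schwartz_entourage : set_system (S * S) :=
  [set P | exists n, exists2 e : R, 0 < e &
    forall f g, seminorm n (g - f : S) < e -> P (f, g)].

Local Lemma schwartz_entourage_filter : Filter schwartz_entourage.
Proof.
split.
- by exists 0%N, 1.
- move=> P Q [n [e e0 HP]] [m [d d0 HQ]].
  exists (maxn n m), (Num.min e d); first by rewrite lt_min e0.
  move=> f g; rewrite lt_min => /andP[fe fd]; split.
    apply: HP; apply: le_lt_trans fe.
    exact: (seminorm_mono (schwartzP _) (leq_maxl n m)).
  apply: HQ; apply: le_lt_trans fd.
  exact: (seminorm_mono (schwartzP _) (leq_maxr n m)).
- move=> P Q PQ [n [e e0 HP]]; exists n, e => // f g fg.
  exact/PQ/HP.
Qed.

Local Lemma schwartz_entourage_diag A : schwartz_entourage A -> diagonal `<=` A.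
Proof.
move=> [n [e e0 HA]] [f g]; rewrite /diagonal /= => <-.
by apply: HA; rewrite subrr seminorm0.
Qed.

Local Lemma schwartz_entourage_inv A :
  schwartz_entourage A -> schwartz_entourage (A^-1)%relation.
Proof.
move=> [n [e e0 HA]]; exists n, e => // f g fg.
by apply: HA; rewrite -opprB seminormN.
Qed.

Local Lemma schwartz_entourage_split A : schwartz_entourage A ->
  exists2 B, schwartz_entourage B & (B \; B)%relation `<=` A.
Proof.
move=> [n [e e0 HA]]; exists [set fg | seminorm n (fg.2 - fg.1 : S) < e / 2].
  by exists n, (e / 2) => //; rewrite divr_gt0.
move=> [f h] [g /= fg gh]; apply: HA.
rewrite -(subrK g h) -addrA (le_lt_trans (seminormD _ _ _))//.
by rewrite [ltRHS]splitr ltrD.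
Qed.

HB.instance Definition _ := isUniform.Build S
  schwartz_entourage_filter schwartz_entourage_diag
  schwartz_entourage_inv schwartz_entourage_split.
HB.instance Definition _ := isPointed.Build S 0.

Lemma schwartz_nbhsP f (A : set S) : nbhs f A <->
  exists n, exists2 e : R, 0 < e & forall g, seminorm n (g - f : S) < e -> A g.
Proof.
rewrite -nbhs_entourageE; split.
  move=> [P [n [e e0 HP]] PA]; exists n, e => // g gf.
  by apply: PA; apply/xsectionP; exact: HP.
move=> [n [e e0 HA]]; exists [set fg | seminorm n (fg.2 - fg.1 : S) < e].
  by exists n, e.
by move=> g /xsectionP /= gf; exact: HA.
Qed.

Local Lemma schwartz_add_continuous : continuous (fun z : S * S => z.1 + z.2).
Proof.
move=> [f g] U /schwartz_nbhsP[n [e e0 HU]].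
exists ([set h | seminorm n (h - f : S) < e / 2], [set h | seminorm n (h - g : S) < e / 2]).
  by split; apply/schwartz_nbhsP; exists n, (e / 2) => //; rewrite divr_gt0.
move=> [u v] /= [uf vg]; apply: HU.
rewrite opprD addrACA (le_lt_trans (seminormD _ _ _))//.
by rewrite [ltRHS]splitr ltrD.
Qed.

Local Lemma schwartz_scale_continuous :
  continuous (fun z : (R[i])^o * S => z.1 *: z.2).
Proof.
move=> [a f] U /schwartz_nbhsP[n [e e0 HU]].
have sf0 : 0 <= seminorm n f by exact/seminorm_ge0/schwartzP.
pose d := Num.min 1 (e / 2 / (seminorm n f + 1)).
have d0 : 0 < d by rewrite lt_min ltr01/= !divr_gt0// ltr_wpDl.
pose d' := e / 2 / (`|a : Rcomplex R| + 1).
have a10 : 0 < `|a : Rcomplex R| + 1 by rewrite ltr_wpDl.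
have d'0 : 0 < d' by rewrite !divr_gt0.
exists ([set b | `|b - a : Rcomplex R| < d], [set h | seminorm n (h - f : S) < d']).
  split; last by apply/schwartz_nbhsP; exists n, d'.
  rewrite /= -nbhs_ballE; exists (real_complex _ d) => /=.
    by rewrite ltcR.
  move=> b; rewrite -ball_normE /= distrC Rcomplex_normE ltcR.
  by [].
move=> [b h] /= [ba hf]; apply: HU.
have -> : b *: h - a *: f = b *: (h - f) + (b - a) *: f.
  by rewrite scalerBr scalerBl addrA subrK.
apply: (le_lt_trans (seminormD _ _ _)); rewrite [ltRHS]splitr.
have bl : `|b : Rcomplex R| <= `|a : Rcomplex R| + 1.
  rewrite -[X in `|X|](subrK (a : Rcomplex R)) addrC.
  rewrite (le_trans (ler_normD _ _))// lerD2l.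
  by apply/ltW/(lt_le_trans ba); rewrite ge_min lexx.
apply: ltr_leD.
  apply: (le_lt_trans (seminormZ _ _ _)).
  apply: (@le_lt_trans _ _ ((`|a : Rcomplex R| + 1) * seminorm n (h - f : S))).
    by rewrite ler_wpM2r// seminorm_ge0//; exact: schwartzP.
  by rewrite mulrC -ltr_pdivlMr.
apply: (le_trans (seminormZ _ _ _)).
apply: (@le_trans _ _ (d * (seminorm n f + 1))).
  by apply: ler_pM => //; [exact: ltW|rewrite lerDl].
by rewrite -ler_pdivlMr ?ltr_wpDl// ge_min lexx orbT.
Qed.

Local Lemma schwartz_locally_convex :
  exists2 B : set_system S, (forall b, b \in B -> convex_set b) & basis B.
Proof.
pose b n e f : set S := [set g | seminorm n (g - f : S) < e].
exists [set B | exists n e f, B = b n e f].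
  move=> _ /set_mem[n [e [f ->]]] g h l /set_mem /= gf /set_mem /= hf.
  apply/mem_set => /=; pose r := complex.Re l%:num.
  have lE : l%:num = (real_complex _ r) :> R[i].
    have : 0 <= l%:num :> R[i] by [].
    by rewrite lecE => /andP[/eqP /= H _]; rewrite /r; case: (l%:num) H => u v /= ->.
  have r0 : 0 <= r.
    by have : 0 <= l%:num :> R[i] by []; rewrite lE lecE => /andP[].
  have r1 : r <= 1.
    by have : l%:num <= 1 :> R[i] by []; rewrite lE lecE => /andP[].
  change (is_true (seminorm n (l%:num *: g + (1 - l%:num) *: h - f : S) < e)).
  have -> : l%:num *: g + (1 - l%:num) *: h - f
      = (real_complex _ r) *: (g - f) + (real_complex _ (1 - r)) *: (h - f) :> S.
    rewrite lE rmorphB rmorph1 !scalerBr addrACA -opprD -scalerDl.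
    by rewrite [_ + (1 - _)]addrC subrK scale1r.
  apply: (le_lt_trans (seminormD _ _ _)).
  apply: (@le_lt_trans _ _ (r * seminorm n (g - f : S) + (1 - r) * seminorm n (h - f : S))).
    have nr (s : R) : 0 <= s -> `|(real_complex _ s) : Rcomplex R| = s.
      move=> s0; rewrite /Num.norm/= /ComplexField.Normc.normc/=.
      by rewrite expr0n addr0 sqrtr_sqr ger0_norm.
    apply: lerD; apply: (le_trans (seminormZ _ _ _)).
      by rewrite nr.
    by rewrite nr// subr_ge0.
  have [r00|rp] := eqVneq r 0; first by rewrite r00 mul0r add0r subr0 mul1r.
  have -> : e = r * e + (1 - r) * e by rewrite -mulrDl addrC subrK mul1r.
  apply: ltr_leD; first by rewrite ltr_pM2l// lt_def rp.
  by rewrite ler_wpM2l ?subr_ge0// ltW.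
split.
  move=> _ [n [e [f ->]]]; rewrite openE => g /= gf.
  apply/schwartz_nbhsP; exists n, (e - seminorm n (g - f : S)); first by rewrite subr_gt0.
  move=> h hg; change (is_true (seminorm n (h - f : S) < e)).
  have -> : (h : S) - f = ((h : S) - g) + ((g : S) - f) :> S by rewrite addrA subrK.
  by apply: (le_lt_trans (seminormD _ _ _)); rewrite -ltrBrDr.
move=> f U /schwartz_nbhsP[n [e e0 HU]]; exists (b n e f) => //=.
by split; [exists n, e, f|rewrite /b/= subrr seminorm0].
Qed.

HB.instance Definition _ := PreTopologicalNmodule_isTopologicalNmodule.Build S
  schwartz_add_continuous.
HB.instance Definition _ := TopologicalNmodule_isTopologicalLmodule.Build R[i] S
  schwartz_scale_continuous.
HB.instance Definition _ := Uniform_isTvs.Build R[i] S schwartz_locally_convex.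

Lemma schwartz_power_boundedE (T : {linear S -> S}) :
  power_bounded T <-> equicontinuous [set: nat] (fun n => iter n T).
Proof.
split=> H f E entE; have := H f E entE; apply: filterS => g Hg n; first by [].
exact: Hg.
Qed.

End SchwartzTopology.

Section PolynomialSymbol.
Variable R : realType.
Implicit Types (p q : {poly R}) (x : R) (i j k n m : nat).

Lemma norm_le_weight1 x : `|x| <= weight 1 x.
Proof.
rewrite /weight expr1 -subr_ge0.
have -> : 1 + `|x| ^+ 2 - `|x| = (`|x| - 2^-1) ^+ 2 + 3 / 4 by field.
by rewrite addr_ge0 ?sqr_ge0.
Qed.

Lemma weightD n m x : weight (n + m) x = weight n x * weight m x.
Proof. exact: exprD. Qed.

Lemma horner_le_weight q :
  exists2 C : R, 0 <= C & exists d, forall x, `|q.[x]| <= C * weight d x.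
Proof.
elim/poly_ind: q => [|q c [C C0 [d H]]].
  by exists 0 => //; exists 0%N => x; rewrite horner0 normr0 mul0r.
exists (C + `|c|); first exact: addr_ge0.
exists d.+1 => x; rewrite hornerMXaddC (le_trans (ler_normD _ _))// mulrDl lerD//.
  rewrite normrM -addn1 weightD mulrA ler_pM// ?mulr_ge0//.
  exact: norm_le_weight1.
by rewrite ler_peMr// weight_ge1.
Qed.

Lemma horner_coercive p : (1 < size p)%N ->
  exists2 A : R, 0 <= A & forall x, `|x| <= A * (1 + `|p.[x]|).
Proof.
elim/poly_ind: p => [|q c IH]; first by rewrite size_poly0.
have cX x : `|x| * `|q.[x]| <= `|(q * 'X + c%:P).[x]| + `|c|.
  rewrite hornerMXaddC -normrM [x * _]mulrC.
  by have := ler_normB (q.[x] * x + c) c; rewrite addrK.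
rewrite size_MXaddC; case: ifP => // _ /[!ltnS] q0.
have [q1|] := ltnP 1 (size q).
  have [A A0 HA] := IH q1.
  exists (1 + A * (1 + `|c|)).
    by rewrite addr_ge0// mulr_ge0// addr_ge0.
  move=> x; set P := `|_.[x]|; have P0 : 0 <= P by exact: normr_ge0.
  have c0 : 0 <= `|c| by []; have ac0 : 0 <= A * `|c| by rewrite mulr_ge0.
  have acp0 : 0 <= A * `|c| * P by rewrite mulr_ge0.
  have ap0 : 0 <= A * P by rewrite mulr_ge0.
  have [x1|x1] := leP `|x| 1; first by nra.
  have qb : `|q.[x]| <= P + `|c|.
    by apply: le_trans (cX x); rewrite ler_peMl//; exact: ltW.
  have := HA x; have : A * `|q.[x]| <= A * (P + `|c|) by rewrite ler_wpM2l.
  by nra.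
move=> q1; have qc : q = (q`_0)%:P by apply: size1_polyC.
have qn0 : `|q`_0| > 0.
  by rewrite normr_gt0 -polyC_eq0 -qc -size_poly_gt0.
exists ((1 + `|c|) / `|q`_0|); first by rewrite divr_ge0// addr_ge0.
move=> x; have := cX x; rewrite {1}qc hornerC.
set P := `|_.[x]|; have P0 : 0 <= P by exact: normr_ge0.
have c0 : 0 <= `|c| by [].
rewrite mulrAC ler_pdivlMr// => H; apply: (le_trans H).
have : 0 <= `|c| * P by rewrite mulr_ge0.
by nra.
Qed.

Lemma weight_comp p : (1 < size p)%N ->
  exists2 K : R, 0 <= K & forall n x, weight n x <= K ^+ n * weight n p.[x].
Proof.
move=> /horner_coercive[A A0 HA]; exists (1 + 2 * A ^+ 2).
  by rewrite addr_ge0// mulr_ge0// sqr_ge0.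
move=> n x; rewrite /weight -exprMn; apply: lerXn2r; rewrite ?nnegrE.
- by rewrite addr_ge0// sqr_ge0.
- by rewrite mulr_ge0 ?addr_ge0 ?mulr_ge0 ?sqr_ge0.
have H : `|x| ^+ 2 <= (A * (1 + `|p.[x]|)) ^+ 2.
  by rewrite lerXn2r ?nnegrE// mulr_ge0// addr_ge0.
have A2 : 0 <= A ^+ 2 by exact: sqr_ge0.
have P2 : 0 <= A ^+ 2 * (1 - `|p.[x]|) ^+ 2 by rewrite mulr_ge0// sqr_ge0.
have P3 : 0 <= `|p.[x]| ^+ 2 by exact: sqr_ge0.
move: H P2; rewrite exprMn !expr2 => H P2; nra.
Qed.

(* The coefficients in (f \o p)^(j) = \sum_i Q_(j, i) (f^(i) \o p). *)
Fixpoint chain_coef p j i : {poly R} :=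
  if j is j'.+1 then
    (chain_coef p j' i)^`() + (if i is i'.+1 then chain_coef p j' i' * p^`() else 0)
  else (i == 0)%:R.

Lemma chain_coef_eq0 p j i : (j < i)%N -> chain_coef p j i = 0.
Proof.
elim: j i => [|j IH] [|i] //=; rewrite ltnS => ji.
by rewrite !IH// 1?ltnW// deriv0 mul0r addr0.
Qed.

Definition chain_rule p (f : R -> R[i]) j x : Rcomplex R :=
  \sum_(i < j.+1) (chain_coef p j i).[x] *: cderive i f p.[x].

Lemma is_derive_chain_rule p (f : R -> R[i]) j x : smooth f ->
  is_derive x 1 (chain_rule p f j) (chain_rule p f j.+1 x).
Proof.
move=> sf.
have dterm i : is_derive x (1 : R)
    (fun y => (chain_coef p j i).[y] *: cderive i f p.[y] : Rcomplex R)
    ((chain_coef p j i)^`().[x] *: cderive i f p.[x] +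
     (chain_coef p j i * p^`()).[x] *: cderive i.+1 f p.[x]).
  rewrite hornerM -scalerA; apply: (@is_derive1_scale _ (horner (chain_coef p j i))
    (fun y => cderive i f p.[y])).
  by apply: (@is_derive1_chain _ _ (horner p)); exact: is_derive_cderive.
have -> : chain_rule p f j = \sum_(i < j.+1)
    (fun y => (chain_coef p j i).[y] *: cderive i f p.[y] : Rcomplex R).
  by apply/funext => y; rewrite fct_sumE.
have -> : chain_rule p f j.+1 x = \sum_(i < j.+1)
    ((chain_coef p j i)^`().[x] *: cderive i f p.[x] +
     (chain_coef p j i * p^`()).[x] *: cderive i.+1 f p.[x] : Rcomplex R).
  rewrite big_split/= /chain_rule.
  under [in LHS]eq_bigr do rewrite /= hornerD scalerDl.
  rewrite [LHS]big_split/=; congr (_ + _).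
    by rewrite [LHS]big_ord_recr/= chain_coef_eq0// deriv0 horner0 scale0r addr0.
  by rewrite [LHS]big_ord_recl/= horner0 scale0r add0r.
by apply: is_derive_sum => i; exact: dterm.
Qed.

Lemma cderive_comp p (f : R -> R[i]) : smooth f ->
  smooth (fun x => f p.[x]) /\
  forall j, cderive j (fun x => f p.[x]) = chain_rule p f j.
Proof.
move=> sf; apply: cderive_uniq; last by move=> j x; exact: is_derive_chain_rule.
by apply/funext => x; rewrite /chain_rule big_ord1 /= hornerE scale1r.
Qed.

Lemma chain_rule_bound p j n : (1 < size p)%N ->
  exists2 C : R, 0 <= C & exists m, forall f x, is_schwartz f ->
    weight n x * `|chain_rule p f j x| <= C * seminorm m f.
Proof.
move=> p1; have [K K0 HK] := weight_comp p1.
pose B (G : (R -> R[i]) -> R -> Rcomplex R) :=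
  exists2 C : R, 0 <= C & exists m, forall f x, is_schwartz f ->
    weight n x * `|G f x| <= C * seminorm m f.
have B0 : B (fun _ _ => 0).
  by exists 0 => //; exists 0%N => f x _; rewrite normr0 mulr0 mul0r.
have BD G H : B G -> B H -> B (fun f x => G f x + H f x).
  move=> [C C0 [m HG]] [D D0 [k HH]]; exists (C + D); first exact: addr_ge0.
  exists (maxn m k) => f x sf.
  apply: (@le_trans _ _ (weight n x * `|G f x| + weight n x * `|H f x|)).
    by rewrite -mulrDr ler_wpM2l ?weight_ge0// ler_normD.
  rewrite mulrDl lerD//.
    apply: (le_trans (HG f x sf)); rewrite ler_wpM2l// seminorm_mono//.
    exact: leq_maxl.
  apply: (le_trans (HH f x sf)); rewrite ler_wpM2l// seminorm_mono//.
  exact: leq_maxr.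
have Bterm i : B (fun f x => (chain_coef p j i).[x] *: cderive i f p.[x]).
  have [C C0 [d HC]] := horner_le_weight (chain_coef p j i).
  exists (C * K ^+ (n + d)); first by rewrite mulr_ge0// exprn_ge0.
  exists (maxn (n + d) i) => f x sf; rewrite normrZ.
  apply: (@le_trans _ _ (C * (weight (n + d) x * `|cderive i f p.[x]|))).
    have -> : C * (weight (n + d) x * `|cderive i f p.[x]|) =
        weight n x * (C * weight d x * `|cderive i f p.[x]|).
      by rewrite weightD; ring.
    by rewrite ler_wpM2l ?weight_ge0// ler_wpM2r.
  rewrite -mulrA ler_wpM2l//.
  apply: (@le_trans _ _ (K ^+ (n + d) * weight (n + d) p.[x] * `|cderive i f p.[x]|)).
    by rewrite ler_wpM2r.
  rewrite -mulrA ler_wpM2l ?exprn_ge0//.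
  by apply: le_seminorm => //; [exact: leq_maxl|exact: leq_maxr].
suff : B (fun f x => \sum_(i < j.+1) (chain_coef p j i).[x] *: cderive i f p.[x]) by [].
elim: j.+1 => [|k IH].
  by apply: eq_ind B0 _ _; apply/funext => f; apply/funext => x; rewrite big_ord0.
apply: eq_ind (BD _ _ IH (Bterm k)) _ _.
by apply/funext => f; apply/funext => x; rewrite big_ord_recr.
Qed.

Lemma seminorm_comp_bound p n : (1 < size p)%N ->
  exists2 C : R, 0 <= C & exists m, forall f x j, is_schwartz f -> (j <= n)%N ->
    weight n x * `|cderive j (fun y => f p.[y]) x| <= C * seminorm m f.
Proof.
move=> p1.
have /choice[C /all_and2[C0 /choice[m HC]]] : forall j, exists C : R, 0 <= C /\
    exists m, forall f x, is_schwartz f ->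
    weight n x * `|chain_rule p f j x| <= C * seminorm m f.
  by move=> j; have [C C0 HC] := chain_rule_bound j n p1; exists C.
exists (\sum_(j < n.+1) C j); first by rewrite sumr_ge0.
exists (\max_(j < n.+1) m j) => f x j sf jn.
rewrite (cderive_comp p sf.1).2; apply: (le_trans (HC j f x sf)).
pose j' := Ordinal (jn : (j < n.+1)%N).
apply: ler_pM => //; first exact: seminorm_ge0.
  by rewrite (bigD1 j')//= lerDl sumr_ge0.
by apply: seminorm_mono => //; exact: (leq_bigmax j').
Qed.

Lemma is_schwartz_comp p (f : R -> R[i]) : (1 < size p)%N -> is_schwartz f ->
  is_schwartz (fun x => f p.[x]).
Proof.
move=> p1 sf; split; first exact: (cderive_comp p sf.1).1.
move=> n j; have [C _ [m H]] := seminorm_comp_bound (maxn n j) p1.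
exists (C * seminorm m f) => x; apply: le_trans (H f x j sf (leq_maxr _ _)).
by rewrite ler_wpM2r// weight_mono// leq_maxl.
Qed.

(* A constant p is excluded: f \o p would then be constant, and not in the
   Schwartz space unless it vanishes. *)
Section CompositionOperator.
Variables (p : {poly R}) (p1 : (1 < size p)%N).

Fact comp_op_subproof (f : schwartz R) :
  (fun x => (f : R -> R[i]) p.[x]) \in @schwartz_pred R.
Proof. exact/schwartz_predP/is_schwartz_comp/schwartzP. Qed.

Definition comp_op (f : schwartz R) : schwartz R :=
  Schwartz (comp_op_subproof f).

Fact comp_op_is_linear : linear comp_op.
Proof. by move=> a f g; apply/val_inj. Qed.

HB.instance Definition _ :=
  GRing.isLinear.Build R[i] (schwartz R) (schwartz R) *:%R comp_op comp_op_is_linear.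

Lemma comp_op_continuous : continuous comp_op.
Proof.
move=> f U /schwartz_nbhsP[n [e e0 HU]].
have [C C0 [m HC]] := seminorm_comp_bound n p1.
apply/schwartz_nbhsP; exists m, (e / (C + 1)).
  by rewrite divr_gt0// ltr_wpDl.
move=> g gf; apply: HU; rewrite -linearB.
apply: (@le_lt_trans _ _ (C * seminorm m (g - f : schwartz R))).
  by apply: seminorm_le => x j jn; apply: HC => //; exact: schwartzP.
apply: (@le_lt_trans _ _ ((C + 1) * seminorm m (g - f : schwartz R))).
  by rewrite ler_wpM2r ?lerDl// seminorm_ge0//; exact: schwartzP.
by rewrite mulrC -ltr_pdivlMr// ltr_wpDl.
Qed.

End CompositionOperator.
End PolynomialSymbol.

(* Main.v *)
Require Import Defs.
From mathcomp Require Import all_boot all_order all_algebra.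
From mathcomp Require Import complex polyrcf ring lra.
From mathcomp Require Import all_classical all_reals all_analysis.
Import Order.TTheory GRing.Theory Num.Theory.
Import numFieldNormedType.Exports.
Local Open Scope ring_scope.

(** Write T for the composition operator of p and p^k for the k-th iterate
of p. Two estimates drive the proof.

If p has no real fixed point, then T^k f tends to 0 geometrically, with
constants that do not depend on f ([seminorm_iter_decay]); this yields power
boundedness as well as mean ergodicity with limit 0. The reason is that p has
degree at least two, so that 1 + p(x)^2 dominates (1 + x^2)^2, whereas the
coefficients of the chain rule grow only polynomially. Measure the n-jet of f
at x by jet_norm a n f x, that is (1 + x^2)^a times the sum of the moduli of
the derivatives of f of order at most n. When a is large, the gain of the
weight beats the chain rule:
(1 + x^2) jet_norm (f o p)(x) <= K jet_norm f (p x) ([jet_norm_comp]). One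
application of T thus costs at most the factor K, and gains a factor 2 where
|x| >= 2K. Since p - X has constant sign and stays away from 0, all orbits
leave the ball of radius 2K after a number N of steps that is independent of
the starting point ([no_fixpoint_escape]). Hence at most N steps are bad, and
all the others halve the jet norm.

Conversely, both power boundedness and mean ergodicity force each seminorm of
T^k f to be o(k) ([power_bounded_sublinear], [mean_ergodic_sublinear]).
Suppose that p has odd degree or a real fixed point. A polynomial of odd
degree at least three has a fixed point as well, so there is one in each case.
Then p, or p o p when the degree is odd, has a fixed point x with multiplier
at least 1 ([expanding_fixpoint]): for instance the last one if the leading coefficient is
positive, the first one if the degree is even and the leading coefficient is
negative. Let q be the polynomial in question. If q'(x) > 1, then
(f o q^k)'(x) = q'(x)^k f'(x) grows exponentially. If q'(x) = 1, then
q = X + s (X - x)^m with m >= 2 and s(x) <> 0, and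
(f o q^k)^(m)(x) = k q^(m)(x) f'(x) + f^(m)(x) grows linearly
([jet_linear_growth]). Choosing f of Gaussian type with f'(x) <> 0 contradicts
the o(k) bound. *)

(** * One composition: weights against chain rule coefficients *)

(** Division by X leaves a nonconstant quotient q, which grows at least linearly;
so does |x|, and |x q(x)| is p(x) up to the constant term. *)
Lemma horner_quadratic_growth {R : realType} (p : {poly R}) : (2 < size p)%N ->
  exists2 B : R, 0 <= B & forall x, 1 + x ^+ 2 <= B * (1 + `|p.[x]|).
Proof.
elim/poly_ind: p => [|q c _]; first by rewrite size_poly0.
rewrite size_MXaddC; case: ifP => // _; rewrite ltnS => /horner_coercive[A A0 HA].
exists (1 + A ^+ 2 + 2 * A + 2 * A * `|c|).
  by rewrite !addr_ge0// ?sqr_ge0// ?mulr_ge0// mulr_ge0.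
move=> x; set P := `|_.[x]|; have P0 : 0 <= P by exact: normr_ge0.
have qx : `|x| * `|q.[x]| <= P + `|c|.
  rewrite -normrM /P hornerMXaddC [x * _]mulrC.
  by have := ler_normB (q.[x] * x + c) c; rewrite addrK.
have c0 : 0 <= `|c| by [].
have x0 : 0 <= `|x| by [].
rewrite -(real_normK (num_real x)).
have h1 : `|x| * `|x| <= `|x| * (A * (1 + `|q.[x]|)) by rewrite ler_wpM2l.
have h2 : A * (`|x| * `|q.[x]|) <= A * (P + `|c|) by rewrite ler_wpM2l.
have h3 : 0 <= (A - `|x|) ^+ 2 by exact: sqr_ge0.
have h4 : 0 <= A ^+ 2 * P by rewrite mulr_ge0// sqr_ge0.
have h5 : 0 <= A * `|c| * P by rewrite !mulr_ge0.
by nra.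
Qed.

Lemma weight_comp_quadratic {R : realType} (p : {poly R}) : (2 < size p)%N ->
  exists2 B : R, 0 <= B & forall n x, weight (n + n) x <= B ^+ n * weight n p.[x].
Proof.
move=> /horner_quadratic_growth[B B0 HB]; exists (2 * B ^+ 2).
  by rewrite mulr_ge0// sqr_ge0.
move=> n x; rewrite addnn -mul2n /weight exprM -exprMn; apply: lerXn2r.
- by rewrite nnegrE sqr_ge0.
- by rewrite nnegrE mulr_ge0 ?addr_ge0 ?mulr_ge0 ?sqr_ge0.
have H : (1 + `|x| ^+ 2) ^+ 2 <= (B * (1 + `|p.[x]|)) ^+ 2.
  rewrite lerXn2r ?nnegrE ?mulr_ge0 ?addr_ge0 ?sqr_ge0//.
  by rewrite real_normK ?num_real.
apply: (le_trans H); rewrite exprMn [2 * _]mulrC -[leRHS]mulrA ler_wpM2l ?sqr_ge0//.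
by have := sqr_ge0 (1 - `|p.[x]|); nra.
Qed.

Definition jet_norm {R : realType} a n (f : R -> R[i]) (x : R) : R :=
  weight a x * \sum_(i < n.+1) `|cderive i f x|.

Lemma jet_norm_ge0 {R : realType} a n (f : R -> R[i]) x : 0 <= jet_norm a n f x.
Proof. by rewrite mulr_ge0 ?weight_ge0// sumr_ge0. Qed.

Lemma chain_coef_le_weight {R : realType} (p : {poly R}) n :
  exists2 C : R, 0 <= C & exists d, forall j i x, (j <= n)%N -> (i <= n)%N ->
    `|(chain_coef p j i).[x]| <= C * weight d x.
Proof.
have /choice[C /all_and2[C0 /choice[d H]]] : forall ji : 'I_n.+1 * 'I_n.+1,
    exists C : R, 0 <= C /\ exists d, forall x,
      `|(chain_coef p ji.1 ji.2).[x]| <= C * weight d x.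
  by move=> ji; have [C ? ?] := horner_le_weight (chain_coef p ji.1 ji.2); exists C.
exists (\sum_ji C ji); first by rewrite sumr_ge0.
exists (\max_ji d ji) => j i x jn im.
pose ji : 'I_n.+1 * 'I_n.+1 := (Ordinal (jn : (j < n.+1)%N), Ordinal (im : (i < n.+1)%N)).
apply: (le_trans (H ji x)); apply: ler_pM => //; first exact: weight_ge0.
  by rewrite (bigD1 ji)//= lerDl sumr_ge0.
by apply: weight_mono; exact: (leq_bigmax ji).
Qed.

(** The exponent a has to exceed the degree of growth of the chain rule
coefficients: composition with p turns weight a into at least weight (2 a), and
the surplus weight a pays for these coefficients and for the factor weight 1
on the left. *)
Lemma jet_norm_comp {R : realType} (p : {poly R}) n : (2 < size p)%N ->
  exists2 a, (n <= a)%N & exists2 K : R, 1 <= K &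
    forall (f : R -> R[i]) x, smooth f ->
      weight 1 x * jet_norm a n (fun y => f p.[y]) x <= K * jet_norm a n f p.[x].
Proof.
move=> p2; have [B B0 HB] := weight_comp_quadratic _ p2.
have [C C0 [d HC]] := chain_coef_le_weight p n.
pose a := (n + d.+1)%N; exists a; first exact: leq_addr.
exists (1 + n.+1%:R * C * B ^+ a).
  by rewrite lerDl !mulr_ge0// exprn_ge0.
move=> f x sf; rewrite /jet_norm.
have -> : \sum_(j < n.+1) `|cderive j (fun y => f p.[y]) x| =
    \sum_(j < n.+1) `|chain_rule p f j x|.
  by apply: eq_bigr => j _; rewrite (cderive_comp p sf).2.
set S := \sum_(i < n.+1) `|cderive i f p.[x]|.
have S0 : 0 <= S by rewrite sumr_ge0.
have H : \sum_(j < n.+1) `|chain_rule p f j x| <= n.+1%:R * (C * weight d x * S).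
  rewrite -[n.+1 in X in _ <= X]card_ord -mulr_natl mulr1 -sumr_const mulr_suml.
  apply: ler_sum => j _; rewrite mul1r (le_trans (ler_norm_sum _ _ _))//.
  rewrite /S (big_ord_widen n.+1 (fun i => `|(chain_coef p j i).[x] *: cderive i f p.[x]|))//.
  rewrite mulr_sumr big_mkcond; apply: ler_sum => i _; case: ifP => _.
    by rewrite normrZ ler_wpM2r// HC// -ltnS.
  by rewrite !mulr_ge0 ?weight_ge0.
apply: (@le_trans _ _ (n.+1%:R * C * B ^+ a * (weight a p.[x] * S))); last first.
  by rewrite ler_wpM2r ?mulr_ge0 ?weight_ge0// lerDr.
apply: (@le_trans _ _ (weight 1 x * (weight a x * (n.+1%:R * (C * weight d x * S))))).
  by rewrite !ler_wpM2l ?weight_ge0.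
have -> : weight 1 x * (weight a x * (n.+1%:R * (C * weight d x * S))) =
  (n.+1%:R * C) * (weight (a + d.+1) x * S).
  by rewrite weightD -[d.+1]addn1 weightD; ring.
rewrite -[X in _ <= X]mulrA ler_wpM2l ?mulr_ge0// mulrA ler_wpM2r//.
apply: le_trans (HB a x); apply: weight_mono.
by rewrite leq_add2l leq_addl.
Qed.

(** * Symbols without fixed points: escape and decay *)

Lemma no_root_constant_sign {R : realType} (s : {poly R}) :
  (forall x, s.[x] != 0) -> exists e : R, `|e| = 1 /\ forall x, 0 < e * s.[x].
Proof.
move=> s0; exists (Num.sg s.[0]); split; first by rewrite normr_sg s0.
move=> x; rewrite ltNge; apply/negP => sx.
have s0x : s.[0] * s.[x] <= 0.
  by rewrite [s.[0]]numEsg -mulrA mulrCA mulr_ge0_le0.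
case: (leP 0 x) => [x0|/ltW x0].
  by have [y _ /rootP /eqP] := polyrcf.poly_ivt x0 s0x; apply/negP.
by rewrite mulrC in s0x; have [y _ /rootP /eqP] := polyrcf.poly_ivt x0 s0x; apply/negP.
Qed.

(** Outside a ball, s is large in modulus by coercivity; on the ball, which is
compact, the positive function e s attains its minimum. *)
Lemma no_root_bounded_away {R : realType} (s : {poly R}) (e : R) :
  (1 < size s)%N -> (forall x, 0 < e * s.[x]) -> `|e| = 1 ->
  exists2 d : R, 0 < d & forall x, d <= e * s.[x].
Proof.
move=> /horner_coercive[A A0 HA] es0 e1.
have AA : - (2 * A) <= 2 * A by lra.
have [c _ Hc] := @EVT_min R (horner (e *: s)) _ _ AA
  (continuous_subspaceT (@continuous_horner _ _)).
exists (Num.min 1 (e * s.[c])); first by rewrite lt_min ltr01 es0.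
move=> x; rewrite ge_min; have [xA|xA] := leP `|x| (2 * A).
  have := Hc x; rewrite in_itv/= -ler_norml xA => /(_ isT).
  by rewrite !hornerZ => ->; rewrite orbT.
have <- : `|s.[x]| = e * s.[x] by rewrite -[RHS]gtr0_norm// normrM e1 mul1r.
by have := HA x; apply: contraTT; rewrite negb_or -!ltNge => /andP[s1 _]; nra.
Qed.

(** With e the sign of p - X and d > 0 a lower bound of e (p - X), each step moves
e x up by at least d. Moreover e p is bounded below, because e (p - X) grows
quadratically; hence the first step sends every starting point above a common
level, and the escape is uniform. *)
Lemma no_fixpoint_escape {R : realType} (p : {poly R}) : (2 < size p)%N ->
  (forall x, p.[x] != x) ->
  forall M : R, exists N, forall k x, (N <= k)%N -> M <= `|iter k (horner p) x|.
Proof.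
move=> p2 nofix M; pose s := p - 'X.
have sE x : s.[x] = p.[x] - x by rewrite !hornerE.
have sz : size s = size p by rewrite size_polyDl// size_polyN size_polyX.
have [e [e1 es0]] : exists e : R, `|e| = 1 /\ forall x, 0 < e * s.[x].
  by apply: no_root_constant_sign => x; rewrite sE subr_eq0.
have [d d0 Hd] : exists2 d : R, 0 < d & forall x, d <= e * s.[x].
  by apply: no_root_bounded_away => //; rewrite sz ltnW.
have [B B0 HB] : exists2 B : R, 0 <= B & forall x, 1 + x ^+ 2 <= B * (1 + `|s.[x]|).
  by apply: horner_quadratic_growth; rewrite sz.
have lb x : - 1 - B <= e * p.[x].
  have es : `|s.[x]| = e * s.[x] by rewrite -[RHS]gtr0_norm// normrM e1 mul1r.
  have ex : - `|x| <= e * x.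
    by rewrite lerNl -mulrN (le_trans (ler_norm _))// normrM e1 mul1r normrN.
  have -> : e * p.[x] = e * s.[x] + e * x by rewrite sE; ring.
  have := HB x; rewrite es -(real_normK (num_real x)).
  have := es0 x; move: ex; set u := e * s.[x]; set v := e * x => ex u0 H.
  rewrite leNgt; apply/negP => uv.
  have h : B * (1 + u) <= B * (`|x| - B) by rewrite ler_wpM2l//; lra.
  have h2 := sqr_ge0 (2 * `|x| - B); have h3 := sqr_ge0 B.
  by move: h H h2 h3; rewrite !expr2; nra.
have grow k x : - 1 - B + k%:R * d <= e * iter k.+1 (horner p) x.
  elim: k => [|k IH]; first by rewrite mul0r addr0 lb.
  set y := iter k.+1 _ x in IH *; rewrite -[iter k.+2 _ x]/(p.[y]).
  by have := Hd y; rewrite sE mulrBr -natr1; lra.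
exists (Num.truncn ((M + 1 + B) / d)).+2 => -[//|k] x; rewrite ltnS => Nk.
apply: (@le_trans _ _ (e * iter k.+1 (horner p) x)); last first.
  by rewrite (le_trans (ler_norm _))// normrM e1 mul1r.
apply: le_trans (grow k x).
have : (M + 1 + B) / d <= k%:R.
  by apply/ltW/(lt_le_trans (truncnS_gt _)); rewrite ler_nat.
by rewrite ler_pdivrMr//; lra.
Qed.

Lemma iter_comp_opE {R : realType} (p : {poly R}) (p1 : (1 < size p)%N) k (f : schwartz R) x :
  (iter k (comp_op p1) f : R -> R[i]) x = (f : R -> R[i]) (iter k (horner p) x).
Proof. by elim: k x => // k IH x; rewrite [iter k.+1 (horner p) x]iterSr -IH. Qed.

(** Every step costs at most the factor K, and each step from the N-th on gains
a factor 2, since the orbit has then left the ball of radius 2 K; the constant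
is (2 K)^N. *)
Lemma jet_norm_decay {R : realType} (p : {poly R}) (p1 : (1 < size p)%N) n :
  (2 < size p)%N -> (forall x, p.[x] != x) ->
  exists2 a, (n <= a)%N & exists2 C : R, 0 <= C & forall k (f : schwartz R) x,
    jet_norm a n (iter k (comp_op p1) f) x <=
      C * 2^-1 ^+ k * jet_norm a n f (iter k (horner p) x).
Proof.
move=> p2 nofix; have [a na [K K1 HK]] := jet_norm_comp _ n p2.
exists a => //; have K0 : 0 <= K by apply: le_trans K1.
have step (f : schwartz R) x :
    weight 1 x * jet_norm a n (comp_op p1 f) x <= K * jet_norm a n f p.[x].
  by apply: HK; have [] := schwartzP f.
have crude k (f : schwartz R) x : jet_norm a n (iter k (comp_op p1) f) x <=
    K ^+ k * jet_norm a n f (iter k (horner p) x).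
  elim: k x => [|k IH] x; first by rewrite expr0 mul1r.
  rewrite iterS [iter k.+1 _ x]iterSr exprS -mulrA.
  apply: (le_trans _ (ler_wpM2l K0 (IH p.[x]))).
  by apply: le_trans (step _ x); rewrite ler_peMl ?jet_norm_ge0 ?weight_ge1.
have [N HN] := no_fixpoint_escape _ p2 nofix (2 * K).
have fine k (f : schwartz R) y :
    (forall i, 2 * K <= `|iter i (horner p) y|) ->
    jet_norm a n (iter k (comp_op p1) f) y <=
      2^-1 ^+ k * jet_norm a n f (iter k (horner p) y).
  elim: k y => [|k IH] y Hy; first by rewrite expr0 mul1r.
  rewrite iterS [iter k.+1 _ y]iterSr exprS -mulrA.
  have {}IH := IH p.[y] (fun i => eq_ind _ (fun z => is_true (_ <= `|z|)) (Hy i.+1) _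
    (iterSr _ _ _)).
  have h2 : (0 : R) <= 2^-1 by [].
  apply: (le_trans _ (ler_wpM2l h2 IH)).
  have KK : 0 < K by apply: lt_le_trans K1.
  set J' := jet_norm _ _ _ p.[y]; set J := jet_norm _ _ _ y.
  have KJ : K * (2 * J) <= K * J'.
    apply: le_trans (step _ y); rewrite mulrCA mulrA ler_wpM2r ?jet_norm_ge0//.
    by apply: le_trans (Hy 0%N) _; exact: norm_le_weight1.
  by rewrite ler_pM2l// in KJ; rewrite mulrC ler_pdivlMr// mulrC.
(* T^(N+l) f = T^N (T^l f): its jet at x is governed by the jet of T^l f at p^N x. *)
exists (K ^+ N * 2 ^+ N); first by rewrite mulr_ge0 ?exprn_ge0.
move=> k f x; have [kN|/ltnW /subnK kE] := leqP k N.
  apply: (le_trans (crude k f x)); rewrite ler_wpM2r ?jet_norm_ge0//.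
  rewrite -mulrA -[leLHS]mulr1; apply: ler_pM; rewrite ?exprn_ge0//.
    exact: ler_weXn2l.
  by rewrite -(subnK kN) exprD -mulrA exprVn divff ?expf_neq0// mulr1 exprn_ege1// ler1n.
rewrite -kE; set l := (k - N)%N.
have -> : K ^+ N * 2 ^+ N * 2^-1 ^+ (l + N) = K ^+ N * 2^-1 ^+ l.
  by rewrite exprD -!mulrA; congr (_ * _); rewrite mulrCA [2^-1 ^+ N]exprVn divff ?mulr1// expf_neq0.
rewrite [iter (l + N) (horner p) x]iterD [in iter (l + N)]addnC iterD.
apply: (le_trans (crude N _ x)); rewrite -mulrA ler_wpM2l ?exprn_ge0//.
apply: fine => i.
by rewrite -iterD; apply: HN; exact: leq_addl.
Qed.

Lemma seminorm_iter_decay {R : realType} (p : {poly R}) (p1 : (1 < size p)%N) n :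
  (2 < size p)%N -> (forall x, p.[x] != x) ->
  exists m, exists2 C : R, 0 <= C & forall k (f : schwartz R),
    seminorm n (iter k (comp_op p1) f) <= C * 2^-1 ^+ k * seminorm m f.
Proof.
move=> p2 nofix; have [a na [C C0 HC]] := jet_norm_decay p p1 n p2 nofix.
exists a, (C * n.+1%:R); first by rewrite mulr_ge0.
move=> k f; apply: seminorm_le => x j jn.
apply: (@le_trans _ _ (jet_norm a n (iter k (comp_op p1) f) x)).
  apply: ler_pM; rewrite ?weight_ge0 ?weight_mono//.
  by rewrite (bigD1 (Ordinal (jn : (j < n.+1)%N)))//= lerDl sumr_ge0.
apply: (le_trans (HC k f x)).
rewrite -!mulrA ler_wpM2l// [leRHS]mulrCA ler_wpM2l ?exprn_ge0//.
rewrite /jet_norm mulr_sumr -[n.+1 in leRHS]card_ord mulr_natl -sumr_const.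
apply: ler_sum => i _; apply: le_seminorm => //; first exact: schwartzP.
by apply: leq_trans na; rewrite -ltnS.
Qed.

(** * Fixed points with multiplier at least one *)

(** The largest root qualifies. The induction on the degree avoids choosing it: at
a root y with r'(y) < 0, the quotient t of r by X - y is negative at y and
eventually positive, so it has a root beyond y, and r' = (X - y) t' at the
roots of t. *)
Lemma root_right_nonneg_deriv {R : realType} (r : {poly R}) (y : R) :
  0 < lead_coef r -> r.[y] = 0 -> exists2 x, r.[x] = 0 & 0 <= r^`().[x].
Proof.
move=> r0 ry.
suff : exists x, [/\ y <= x, r.[x] = 0 & 0 <= r^`().[x]] by move=> [x []]; exists x.
have [n] := ubnP (size r); elim: n => // n IH in r y r0 ry *; rewrite ltnS => rn.
have /factor_theorem[t rE] : root r y by apply/rootP.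
have r'E x : r^`().[x] = t.[x] + (x - y) * t^`().[x].
  by rewrite rE derivM derivXsubC !hornerE addrC mulrC.
have t0 : 0 < lead_coef t by move: r0; rewrite rE lead_coefM lead_coefXsubC mulr1.
have [ty|ty] := leP 0 t.[y].
  by exists y; split; rewrite // r'E subrr mul0r addr0.
have [N HN] := poly_pinfty_gt_lc t0.
have [] := @polyrcf.poly_ivt _ t y (Num.max y N).
- by rewrite le_max lexx.
- rewrite mulr_le0_ge0 ?ltW// (lt_le_trans t0)// HN//.
  by rewrite le_max lexx orbT.
move=> z; rewrite in_itv => /andP[yz _] /rootP tz.
have [|x [zx tx t'x]] := IH t z t0 tz.
  apply: leq_trans rn; rewrite rE size_Mmonic ?monicXsubC -?lead_coef_eq0 ?gt_eqF//.
  by rewrite size_XsubC addn2.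
have yx := le_trans yz zx.
exists x; split=> //; first by rewrite rE hornerM tx mul0r.
by rewrite r'E tx add0r mulr_ge0 ?subr_ge0.
Qed.

(** In odd degree the leading coefficient of p o p is positive even if that of p is
not, and p has a fixed point because p - X has odd degree. In even degree with
negative leading coefficient, the reflection X -> - X exchanges the first and
the last fixed point. *)
Lemma expanding_fixpoint {R : realType} (p : {poly R}) : (2 < size p)%N ->
  odd (size p).-1 \/ (exists x, p.[x] = x) ->
  exists (q : {poly R}) (h : nat) (x : R),
    [/\ (0 < h)%N, forall y, q.[y] = iter h (horner p) y, q != 'X, q.[x] = x &
      1 <= q^`().[x]].
Proof.
move=> p2 H.
have szB (s : {poly R}) : (2 < size s)%N -> size (s - 'X) = size s /\
    lead_coef (s - 'X) = lead_coef s.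
  by move=> ss; rewrite size_polyDl ?lead_coefDl// size_polyN size_polyX.
have neX (s : {poly R}) : (2 < size s)%N -> s != 'X.
  by apply: contraTneq => ->; rewrite size_polyX.
have fixE (s : {poly R}) x : (s - 'X).[x] = 0 -> s.[x] = x.
  by rewrite !hornerE => /subr0_eq.
have p0 : lead_coef p != 0 by rewrite lead_coef_eq0 -size_poly_gt0 (ltn_trans _ p2).
have [y py] : exists x, p.[x] = x.
  case: H => // po; have [] := @odd_poly_root _ (p - 'X).
    by rewrite (szB _ p2).1 -[size p]prednK ?(ltn_trans _ p2)//= po.
  by move=> x /rootP /fixE; exists x.
have yroot (s : {poly R}) : s.[y] = y -> (s - 'X).[y] = 0.
  by move=> sy; rewrite !hornerE sy subrr.
have dE (s : {poly R}) x : (s - 'X)^`().[x] = s^`().[x] - 1.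
  by rewrite derivB derivX !hornerE.
case: (boolP (odd (size p).-1)) => podd.
  pose q := p \Po p.
  have sq : (2 < size q)%N.
    suff : (1 < (size q).-1)%N by case: (size q).
    rewrite size_comp_poly; have d2 : (1 < (size p).-1)%N by case: (size p) p2.
    by apply: (@leq_mul 2 1) => //; exact: ltnW.
  have qy : q.[y] = y by rewrite horner_comp py py.
  have lq : 0 < lead_coef (q - 'X).
    rewrite (szB _ sq).2 lead_coef_comp ?(ltnW p2)// -exprS.
    by rewrite exprn_even_gt0/= ?podd// p0 orbT.
  have [x /fixE qx] := root_right_nonneg_deriv _ _ lq (yroot _ qy).
  rewrite dE subr_ge0 => q'x; exists q, 2%N, x; split=> // [z|].
    by rewrite horner_comp.
  exact: neX.
have [p_gt0|p_lt0] := ltP 0 (lead_coef p).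
  have lp : 0 < lead_coef (p - 'X) by rewrite (szB _ p2).2.
  have [x /fixE px] := root_right_nonneg_deriv _ _ lp (yroot _ py).
  by rewrite dE subr_ge0 => p'x; exists p, 1%N, x; split=> //; exact: neX.
pose r := - ((p - 'X) \Po - 'X).
have lr : 0 < lead_coef r.
  rewrite lead_coefN lead_coef_comp ?size_polyN ?size_polyX//.
  rewrite (szB _ p2).2 (szB _ p2).1 lead_coefN lead_coefX -signr_odd.
  by rewrite (negbTE podd) mulr1 oppr_gt0 lt_neqAle p0.
have rE x : r.[x] = - (p - 'X).[- x] by rewrite hornerN horner_comp hornerN hornerX.
have ry : r.[- y] = 0 by rewrite rE opprK yroot ?oppr0.
have [x] := root_right_nonneg_deriv _ _ lr ry.
rewrite rE => /eqP; rewrite oppr_eq0 => /eqP /fixE px.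
rewrite derivN deriv_comp derivN derivX mulrN1 opprK horner_comp hornerN hornerX.
rewrite dE subr_ge0 => p'x.
by exists p, 1%N, (- x); split=> //; exact: neX.
Qed.

(** * Schwartz functions with prescribed nonzero derivative *)

(** The product of q and exp(- x^2), kept as a real multiple of 1 so that the
product rule for real scalars applies. *)
Definition gaussian {R : realType} (q : {poly R}) : R -> Rcomplex R :=
  fun x => q.[x] *: (expR (- x ^+ 2) *: 1).

Lemma is_derive_gaussian {R : realType} (q : {poly R}) (x : R) :
  is_derive x 1 (gaussian q) (gaussian (q^`() - 2%:P * 'X * q) x).
Proof.
have dg (y : R) : is_derive y 1 (fun z : R => expR z *: (1 : Rcomplex R)) (expR y *: 1).
  have := @is_derive1_scale R expR (fun=> 1) y _ _ (is_derive_expR y)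
    (is_derive_cst (1 : Rcomplex R) y 1).
  by rewrite scaler0 addr0.
have dp : is_derive x 1 (horner (- 'X^2)) (- 2 * x).
  split; first exact: derivable_horner.
  rewrite -derive1E -derivE.
  by rewrite derivN derivXn hornerN hornerMn hornerXn /= expr1 mulNr mulr_natl.
have sqE (y : R) : (- 'X^2).[y] = - y ^+ 2 by rewrite hornerN hornerXn.
have de := is_derive1_chain (dg _) dp.
have dq : is_derive x 1 (horner q) (q^`().[x]).
  by split; [exact: derivable_horner|rewrite -derive1E -derivE].
have -> : gaussian q = fun y =>
    q.[y] *: ((fun z : R => expR z *: (1 : Rcomplex R)) \o horner (- 'X^2)) y.
  by apply/funext => y; rewrite /gaussian /= sqE.
have -> : gaussian (q^`() - 2%:P * 'X * q) x =
  q^`().[x] *: ((fun z : R => expR z *: (1 : Rcomplex R)) \o horner (- 'X^2)) x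
  + q.[x] *: ((- 2 * x) *: (expR (- 'X^2).[x] *: 1)).
  rewrite /gaussian /= sqE !scalerA -scalerDl hornerD hornerN !hornerM hornerC hornerX.
  by congr (_ *: _); ring.
exact: is_derive1_scale.
Qed.

Lemma gaussian_cderive {R : realType} (q : {poly R}) :
  smooth (gaussian q) /\ forall j,
    cderive j (gaussian q) = gaussian (iter j (fun r => r^`() - 2%:P * 'X * r) q).
Proof.
apply: (@cderive_uniq _ _ (fun j => gaussian (iter j (fun r => r^`() - 2%:P * 'X * r) q))) => // j x.
exact: is_derive_gaussian.
Qed.

Lemma Rcomplex_norm1 {R : realType} : `|1 : Rcomplex R| = 1.
Proof. exact: ComplexField.Normc.normc1. Qed.

(** With t = 1 + x^2, this is t^N exp(- t) <= N!, which follows from the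
exponential series. *)
Lemma gaussian_rapid {R : realType} (q : {poly R}) n :
  exists M, forall x, weight n x * `|gaussian q x| <= M.
Proof.
have [C C0 [d HC]] := horner_le_weight q.
exists (C * ((n + d).+1`!%:R * expR 1)) => x.
rewrite /gaussian !normrZ Rcomplex_norm1 mulr1 (ger0_norm (expR_ge0 _)).
apply: (@le_trans _ _ (C * (weight (n + d) x * expR (- x ^+ 2)))).
  rewrite weightD mulrA [C * _]mulrCA -!mulrA ler_wpM2l ?weight_ge0//.
  by rewrite mulrA ler_wpM2r ?expR_ge0.
rewrite ler_wpM2l//.
have t0 : 0 <= 1 + x ^+ 2 by rewrite addr_ge0 ?sqr_ge0.
have -> : - x ^+ 2 = 1 - (1 + x ^+ 2) by ring.
rewrite expRB mulrA ler_pdivrMr ?expR_gt0// mulrAC ler_wpM2r ?expR_ge0//.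
apply: (@le_trans _ _ (weight (n + d).+1 x)); first exact: weight_mono.
rewrite /weight real_normK ?num_real// mulrC -ler_pdivrMr ?ltr0n ?fact_gt0//.
have h := expR_ge1Dxn (n + d) t0. by apply: le_trans h; rewrite lerDr.
Qed.

Lemma gaussian_schwartz {R : realType} (q : {poly R}) : is_schwartz (gaussian q).
Proof.
split; first exact: (gaussian_cderive q).1.
by move=> n j; rewrite (gaussian_cderive q).2; exact: gaussian_rapid.
Qed.

(** (X - x) exp(- X^2) has derivative exp(- x^2) at x. *)
Lemma schwartz_nonzero_deriv {R : realType} (x : R) :
  exists f : schwartz R, cderive 1 f x != 0.
Proof.
have fP : gaussian ('X - x%:P) \in @schwartz_pred R.
  exact/schwartz_predP/gaussian_schwartz.
exists (Schwartz fP); rewrite (gaussian_cderive _).2 /= /gaussian.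
rewrite derivXsubC !hornerE subrr mulr0 subr0 scale1r.
by rewrite -normr_eq0 normrZ Rcomplex_norm1 mulr1 normr_eq0 expR_eq0.
Qed.

(** * Derivatives of iterates at a fixed point *)

Lemma chain_coef0 {R : realType} (q : {poly R}) j : chain_coef q j.+1 0 = 0.
Proof.
elim: j => [|j IH]; first by rewrite /= addr0 -polyC1 derivC.
by rewrite -[LHS]/((chain_coef q j.+1 0)^`() + 0) IH deriv0 addr0.
Qed.

Lemma chain_coef1 {R : realType} (q : {poly R}) j : chain_coef q j.+1 1 = q^`(j.+1).
Proof.
elim: j => [|j IH]; first by rewrite /= deriv0 add0r mul1r.
by rewrite -[LHS]/((chain_coef q j.+1 1)^`() + chain_coef q j.+1 0 * _) IH chain_coef0 mul0r addr0.
Qed.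

Lemma derivXsubCX {R : realType} (x : R) k :
  (('X - x%:P) ^+ k)^`() = k%:R * ('X - x%:P) ^+ k.-1.
Proof. by rewrite deriv_exp derivXsubC mul1r mulr_natl. Qed.

(** When q is tangent to the identity at x to order m >= 2, the m-th derivative of
f o q at x is f^(m)(x) + q^(m)(x) f'(x). To see this, one follows how fast the chain
rule coefficients approach those of the identity near x: here for the
coefficient of f', in [chain_coef_tangent] for the others. *)
Lemma derivn_tangent {R : realType} (q s : {poly R}) (x : R) m j :
  q = 'X + s * ('X - x%:P) ^+ m -> (j < m)%N ->
  exists r, q^`(j.+1) = (j == 0)%:R + r * ('X - x%:P) ^+ (m - j.+1).
Proof.
move=> qE; elim: j => [|j IH] jm.
  exists (s^`() * ('X - x%:P) + m%:R * s).
  rewrite derivn1 qE derivD derivX derivM derivXsubCX.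
  by case: m jm {qE} => // m _; rewrite subn1 /= exprS; ring.
have [r rE] := IH (ltnW jm).
exists (r^`() * ('X - x%:P) + (m - j.+1)%:R * r).
rewrite derivnS rE derivD derivM derivXsubCX.
rewrite (_ : ((j == 0)%:R)^`() = 0) ?add0r; last first.
  by case: j {rE jm IH} => *; rewrite ?deriv0 -?polyC1 ?derivC.
by rewrite -(subnSK jm) /= exprS; ring.
Qed.

(** The coefficient of f^(i) in the derivative of order j + 1 of f o q is a sum of
products of i derivatives of q of total order j + 1. For i >= 2 none of these has
order above j, hence the exponent m - j where [derivn_tangent] has m - (j + 1).
This extra factor makes the coefficient vanish at x for j + 1 = m, unless
i = m. *)
Lemma chain_coef_tangent {R : realType} (q s : {poly R}) (x : R) m j i :
  q = 'X + s * ('X - x%:P) ^+ m -> (j < m)%N ->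
  exists r, chain_coef q j.+1 i.+2 = (j == i.+1)%:R + r * ('X - x%:P) ^+ (m - j).
Proof.
move=> qE; elim: j i => [|j IH] i jm.
  by exists 0; rewrite /= deriv0 !mul0r.
have jm' : (j < m)%N by exact: ltnW.
have [t qt] : exists t, q^`() = 1 + t * ('X - x%:P) ^+ (m - j.+1).
  have [t] := derivn_tangent _ _ _ _ _ qE (leq_ltn_trans (leq0n _) jm).
  rewrite derivn1 => ->; exists (t * ('X - x%:P) ^+ j).
  rewrite -mulrA -exprD; congr (_ + _ * _ ^+ _).
  by rewrite addnBA// -[j.+1]addn1 subnDl.
have [r rE] := IH i jm'.
have [r' r'E] : exists r, chain_coef q j.+1 i.+1 = (j == i)%:R + r * ('X - x%:P) ^+ (m - j.+1).
  case: i {rE} => [|i]; first by rewrite chain_coef1; exact: (derivn_tangent _ _ _ _ _ qE).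
  have [r' ->] := IH i jm'; exists (r' * ('X - x%:P)).
  by rewrite -mulrA -exprS subnSK.
exists (r^`() * ('X - x%:P) + r * (m - j)%:R + r' + (j == i)%:R * t
  + r' * t * ('X - x%:P) ^+ (m - j.+1)).
rewrite -[LHS]/((chain_coef q j.+1 i.+2)^`() + chain_coef q j.+1 i.+1 * q^`()).
rewrite rE r'E qt derivD derivM derivXsubCX eqSS.
rewrite (_ : ((j == i.+1)%:R)^`() = 0) ?add0r; last first.
  by case: (j == i.+1); rewrite ?deriv0 -?polyC1 ?derivC.
by rewrite -(subnSK jm') /= exprS; ring.
Qed.

Lemma derivn_XsubC_neq0 {R : realType} (s : {poly R}) (x : R) m :
  s.[x] != 0 -> (s * ('X - x%:P) ^+ m)^`(m).[x] != 0.
Proof.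
elim: m s => [|m IH] s sx; first by rewrite mulr1.
rewrite derivSn derivM derivXsubCX exprSr /=.
rewrite (_ : _ + _ = (s^`() * ('X - x%:P) + m.+1%:R * s) * ('X - x%:P) ^+ m);
  last by ring.
apply: IH; rewrite !hornerE subrr mulr0 add0r -polyC1 -polyCMn hornerC.
by rewrite mulf_neq0// pnatr_eq0.
Qed.

Lemma tangent_fixpoint {R : realType} {q s : {poly R}} {x : R} {m} :
  q = 'X + s * ('X - x%:P) ^+ m.+1 -> q.[x] = x.
Proof.
move=> ->; rewrite hornerD hornerX hornerM horner_exp hornerXsubC subrr.
by rewrite expr0n mulr0 addr0.
Qed.

Lemma cderive1_comp {R : realType} (q : {poly R}) (f : R -> R[i]) x : smooth f ->
  cderive 1 (fun y => f q.[y]) x = q^`().[x] *: cderive 1 f q.[x].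
Proof.
move=> sf; rewrite (cderive_comp q sf).2 /chain_rule big_ord_recl big_ord1.
by rewrite chain_coef0 horner0 scale0r add0r chain_coef1 derivn1.
Qed.

Lemma cderive_comp_tangent {R : realType} (q s : {poly R}) (x : R) m (f : R -> R[i]) :
  q = 'X + s * ('X - x%:P) ^+ m.+2 -> smooth f ->
  cderive m.+2 (fun y => f q.[y]) x = q^`(m.+2).[x] *: cderive 1 f x + cderive m.+2 f x.
Proof.
move=> qE sf.
have qx := tangent_fixpoint qE.
rewrite (cderive_comp q sf).2 /chain_rule qx big_ord_recl chain_coef0 horner0 scale0r add0r.
rewrite big_ord_recl -[lift _ _ : nat]/1%N chain_coef1; congr (_ + _).
have cE (i : nat) : (chain_coef q m.+2 i.+2).[x] = (m == i)%:R.
  have [r ->] := chain_coef_tangent q s x _ m.+1 i qE (ltnSn _).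
  rewrite subSnn expr1 hornerD hornerM hornerXsubC subrr mulr0 addr0 eqSS.
  by rewrite hornerMn -polyC1 hornerC.
transitivity (\sum_(i < m.+1) (m == i)%:R *: cderive i.+2 f x).
  by apply: eq_bigr => i _; rewrite -cE.
rewrite big_ord_recr big1 => [|i _]; last by rewrite (gtn_eqF (ltn_ord i)) scale0r.
by rewrite [LHS]add0r eqxx scale1r.
Qed.

Lemma smooth_iter {R : realType} (q : {poly R}) (f : R -> R[i]) k : smooth f ->
  smooth (fun y => f (iter k (horner q) y)).
Proof.
move=> sf; elim: k => // k IH.
have -> : (fun y => f (iter k.+1 (horner q) y)) =
    (fun y => (fun z => f (iter k (horner q) z)) q.[y]).
  by apply/funext => y; rewrite iterSr.
by have [] := cderive_comp q IH.
Qed.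

Lemma cderive_iterS {R : realType} (q : {poly R}) (f : R -> R[i]) j k :
  cderive j (fun y => f (iter k.+1 (horner q) y)) =
  cderive j (fun y => (fun z => f (iter k (horner q) z)) q.[y]).
Proof. by congr cderive; apply/funext => y; rewrite iterSr. Qed.

Lemma cderive1_iter {R : realType} (q : {poly R}) (x : R) (f : R -> R[i]) k :
  q.[x] = x -> smooth f ->
  cderive 1 (fun y => f (iter k (horner q) y)) x = q^`().[x] ^+ k *: cderive 1 f x.
Proof.
move=> qx sf; elim: k => [|k IH]; first by rewrite expr0 scale1r.
rewrite cderive_iterS (cderive1_comp q (fun y => f (iter k (horner q) y))) ?qx.
  by rewrite IH scalerA exprS.
exact: smooth_iter.
Qed.

(** On the span of the jets of order 1 and m, composition with q acts by a unipotent
matrix with off-diagonal entry q^(m)(x), whose k-th power has k times that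
entry. *)
Lemma cderive_iter_tangent {R : realType} (q s : {poly R}) (x : R) m (f : R -> R[i]) k :
  q = 'X + s * ('X - x%:P) ^+ m.+2 -> smooth f ->
  cderive m.+2 (fun y => f (iter k (horner q) y)) x =
    (k%:R * q^`(m.+2).[x]) *: cderive 1 f x + cderive m.+2 f x.
Proof.
move=> qE sf; elim: k => [|k IH]; first by rewrite mul0r scale0r add0r.
have qx := tangent_fixpoint qE.
have q'x : q^`().[x] = 1.
  have [r] := derivn_tangent q s x _ 0 qE isT.
  rewrite derivn1 => ->; rewrite subn1 hornerD hornerM horner_exp hornerXsubC subrr.
  by rewrite expr0n mulr0 addr0 -polyC1 hornerC.
rewrite cderive_iterS.
rewrite (cderive_comp_tangent q s x m (fun y => f (iter k (horner q) y)) qE); last exact: smooth_iter.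
rewrite IH cderive1_iter// q'x expr1n scale1r addrA -scalerDl -natr1.
by congr (_ *: _ + _); ring.
Qed.

(** The order j is 1 if q'(x) > 1, by the inequality of Bernoulli, and otherwise the
multiplicity of x as a root of q - X. *)
Lemma jet_linear_growth {R : realType} (q : {poly R}) (x : R) :
  q != 'X -> q.[x] = x -> 1 <= q^`().[x] ->
  exists j, forall f : R -> R[i], smooth f -> cderive 1 f x != 0 ->
    exists2 c : R, 0 < c & exists M, forall k,
      c * k%:R <= `|cderive j (fun y => f (iter k (horner q) y)) x| + M.
Proof.
move=> qX qx; rewrite le_eqVlt => /predU1P[/esym q'x|q'x]; last first.
  exists 1%N => f sf f'x; exists ((q^`().[x] - 1) * `|cderive 1 f x|).
    by rewrite mulr_gt0 ?subr_gt0// normr_gt0.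
  exists 0 => k; rewrite cderive1_iter// normrZ addr0 mulrAC ler_wpM2r//.
  rewrite ger0_norm; last by rewrite exprn_ge0// ltW// (lt_trans _ q'x).
  set d := q^`().[x] in q'x *.
  suff : 1 + (d - 1) * k%:R <= d ^+ k by apply: le_trans; rewrite lerDr.
  elim: k => [|k IH]; first by rewrite mulr0 addr0.
  have d0 : 0 <= d by rewrite ltW// (lt_trans _ q'x).
  rewrite exprS; apply: le_trans (ler_wpM2l d0 IH).
  rewrite -natr1 -subr_ge0 (_ : _ - _ = (d - 1) ^+ 2 * k%:R); last by ring.
  by rewrite mulr_ge0 ?sqr_ge0.
have [m [s]] := multiplicity_XsubC (q - 'X) x.
rewrite subr_eq0 qX implyTb => sx qE.
have {}sx : s.[x] != 0 by [].
have {}qE : q = 'X + s * ('X - x%:P) ^+ m by rewrite -qE addrC subrK.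
case: m qE => [|[|m]] qE.
- move: qx; rewrite qE expr0 mulr1 hornerD hornerX => /eqP.
  by rewrite -subr_eq0 addrC addKr (negbTE sx).
- move: q'x; rewrite qE derivD derivX derivM derivXsubCX expr1 expr0 !mulr1.
  rewrite hornerD hornerD hornerM hornerXsubC subrr mulr0 add0r -polyC1 hornerC => /eqP.
  by rewrite -subr_eq0 addrC addKr (negbTE sx).
have c0 : q^`(m.+2).[x] != 0.
  by rewrite qE derivnD derivn_poly0 ?size_polyX// add0r derivn_XsubC_neq0.
exists m.+2 => f sf f'x; exists (`|q^`(m.+2).[x]| * `|cderive 1 f x|).
  by rewrite mulr_gt0 ?normr_gt0.
exists `|cderive m.+2 f x| => k; rewrite (cderive_iter_tangent _ _ _ _ _ _ qE)//.
set u := _ *: _; set v := cderive m.+2 f x.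
have -> : `|q^`(m.+2).[x]| * `|cderive 1 f x| * k%:R = `|u|.
  by rewrite normrZ normrM normr_nat mulrAC [`|_| * k%:R]mulrC.
by have := ler_normB (u + v) v; rewrite addrK.
Qed.

(** * Seminorms of orbits and of Cesaro means *)

Lemma norm_real_complex {R : realType} (r : R) : 0 <= r ->
  `|(real_complex _ r) : Rcomplex R| = r.
Proof.
move=> r0; rewrite /Num.norm/= /ComplexField.Normc.normc/=.
by rewrite expr0n addr0 sqrtr_sqr ger0_norm.
Qed.

Lemma seminorm_natrZ {R : realType} n k (f : schwartz R) :
  seminorm n (k%:R *: f : schwartz R) <= k%:R * seminorm n f.
Proof.
apply: (le_trans (seminormZ _ _ _)); rewrite -(rmorph_nat (real_complex R)).
by rewrite norm_real_complex.
Qed.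

Lemma seminorm_natrVZ {R : realType} n k (f : schwartz R) :
  seminorm n (k%:R^-1 *: f : schwartz R) <= k%:R^-1 * seminorm n f.
Proof.
apply: (le_trans (seminormZ _ _ _)); rewrite -(rmorph_nat (real_complex R)) -fmorphV.
by rewrite norm_real_complex.
Qed.

Lemma seminorm_sum {R : realType} n (s : seq nat) (F : nat -> schwartz R) :
  seminorm n (\sum_(i <- s) F i : schwartz R) <= \sum_(i <- s) seminorm n (F i).
Proof.
elim: s => [|i s IH]; first by rewrite !big_nil seminorm0.
by rewrite !big_cons; apply: (le_trans (seminormD _ _ _)); rewrite lerD2l.
Qed.

Lemma geometric_sum_le1 {R : realType} k : \sum_(1 <= i < k.+1) (2^-1 : R) ^+ i <= 1.
Proof.
suff -> : \sum_(1 <= i < k.+1) (2^-1 : R) ^+ i = 1 - 2^-1 ^+ k.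
  by rewrite gerBl exprn_ge0.
elim: k => [|k IH]; first by rewrite big_geq// subrr.
by rewrite big_nat_recr//= IH exprS; field.
Qed.

(** The common consequence of power boundedness and mean ergodicity that fails in
the presence of an expanding fixed point. *)
Definition sublinear_orbits {R : realType} (T : schwartz R -> schwartz R) :=
  forall n (f : schwartz R) (e : R), 0 < e ->
    exists N, forall k, (N <= k)%N -> seminorm n (iter k T f) <= e * k%:R.

(** Equicontinuity at 0 bounds the orbit of a small multiple of f, hence that of
f. *)
Lemma power_bounded_sublinear {R : realType} (U : {linear schwartz R -> schwartz R}) :
  power_bounded (X := schwartz R) U -> sublinear_orbits U.
Proof.
move=> pb n f e e0.
have entE : entourage
    [set gh : schwartz R * schwartz R | seminorm n (gh.2 - gh.1 : schwartz R) < 1]%classic.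
  by exists n, 1.
have /schwartz_nbhsP[m [d d0 Hd]] := pb 0 _ entE.
have U0 k : iter k U 0 = 0 by elim: k => //= k ->; rewrite linear0.
pose a := d / (2 * (seminorm m f + 1)).
have f0 : 0 <= seminorm m f by exact/seminorm_ge0/schwartzP.
have a0 : 0 < a by rewrite divr_gt0// mulr_gt0// ltr_wpDl.
have UZ k (b : R[i]) g : iter k U (b *: g) = b *: iter k U g.
  by elim: k => //= k ->; rewrite linearZ.
have small : seminorm m ((real_complex _ a) *: f - 0 : schwartz R) < d.
  rewrite subr0; apply: (le_lt_trans (seminormZ _ _ _)); rewrite norm_real_complex ?ltW//.
  rewrite /a mulrAC ltr_pdivrMr ?mulr_gt0 ?ltr_wpDl//.
  by rewrite ltr_pM2l//; lra.
have bnd k : seminorm n (iter k U f) < a^-1.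
  have := Hd _ small k; rewrite /= U0 subr0 UZ => H.
  have -> : iter k U f = (real_complex _ a^-1) *: ((real_complex _ a) *: iter k U f).
    by rewrite scalerA -rmorphM mulVf ?rmorph1 ?scale1r// gt_eqF.
  apply: (le_lt_trans (seminormZ _ _ _)); rewrite norm_real_complex ?invr_ge0 ?ltW//.
  by rewrite -[ltRHS]mulr1 ltr_pM2l// invr_gt0.
exists (Num.truncn (a^-1 / e)).+1 => k Nk.
apply: (le_trans (ltW (bnd k))); rewrite mulrC -ler_pdivrMr//.
by apply/ltW/(lt_le_trans (truncnS_gt _)); rewrite ler_nat.
Qed.

(** The last term of a sum of orbit points is a difference of two such sums, that
is (k + 1) c_(k+1) - k c_k for the Cesaro means c_k, which both converge. *)
Lemma mean_ergodic_sublinear {R : realType} (U : {linear schwartz R -> schwartz R}) :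
  mean_ergodic (X := schwartz R) U -> sublinear_orbits U.
Proof.
move=> [P _ cP] n f e e0; have cvg := cP f.
set g := P f in cvg.
have [N _ HN] : (\forall k \near \oo,
    seminorm n (cesaro_mean U k f - g : schwartz R) < e / 4)%classic.
  apply: (cvg (fun h => seminorm n (h - g : schwartz R) < e / 4)).
  by apply/schwartz_nbhsP; exists n, (e / 4); rewrite ?divr_gt0.
pose L := Num.truncn (2 * seminorm n g / e).
exists (maxn N L.+1).+1 => -[//|k]; rewrite ltnS geq_max => /andP[Nk Lk].
have sumE j : j%:R *: cesaro_mean U j f = \sum_(1 <= i < j.+1) iter i U f.
  case: j => [|j]; first by rewrite scale0r big_geq.
  by rewrite scalerA divff ?scale1r// pnatr_eq0.
have -> : iter k.+1 U f =
    k.+1%:R *: (cesaro_mean U k.+1 f - g) - k%:R *: (cesaro_mean U k f - g) + g.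
  have zE (a u b c : schwartz R) : a + u - (b + c) - (a - b) + c = u.
    by rewrite opprB -[LHS]addrA [b - a + c]addrAC addrA subrK addrAC subrr add0r.
  rewrite !scalerBr !sumE big_nat_recr// -[X in X *: g]natr1 scalerDl scale1r.
  exact/esym/zE.
apply: (le_trans (seminormD _ _ _)).
have h1 : seminorm n
    (k.+1%:R *: (cesaro_mean U k.+1 f - g) - k%:R *: (cesaro_mean U k f - g) : schwartz R)
    <= k.+1%:R * (e / 4) + k%:R * (e / 4).
  apply: (le_trans (seminormD _ _ _)); rewrite seminormN.
  by apply: lerD; apply: (le_trans (seminorm_natrZ _ _ _));
    rewrite ler_wpM2l// ltW// HN//= ltnW.
have : 2 * seminorm n g / e < k%:R by apply: (lt_le_trans (truncnS_gt _)); rewrite ler_nat.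
rewrite ltr_pdivrMr// => h2; apply: (le_trans (lerD h1 (lexx _))).
by rewrite -natr1; lra.
Qed.

Lemma no_fixpoint_power_bounded {R : realType} {p : {poly R}} (p1 : (1 < size p)%N) :
  (2 < size p)%N -> (forall x, p.[x] != x) ->
  power_bounded (X := schwartz R) (comp_op p1).
Proof.
move=> p2 nofix f E [n [e e0 HE]].
have [m [C C0 HC]] := seminorm_iter_decay p p1 n p2 nofix.
have TB k (g h : schwartz R) : iter k (comp_op p1) (g - h) =
    iter k (comp_op p1) g - iter k (comp_op p1) h.
  by elim: k => //= k ->; rewrite linearB.
apply/schwartz_nbhsP; exists m, (e / (C + 1)); first by rewrite divr_gt0// ltr_wpDl.
move=> g gf k; apply: HE; rewrite -TB; apply: (le_lt_trans (HC _ _)).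
have s0 : 0 <= seminorm m (g - f : schwartz R) by exact/seminorm_ge0/schwartzP.
rewrite ltr_pdivlMr ?ltr_wpDl// mulrC in gf.
apply: le_lt_trans gf; rewrite ler_wpM2r//.
apply: (@le_trans _ _ C); last by rewrite lerDl.
by rewrite ler_piMr// exprn_ile1// invf_le1// ler1n.
Qed.

Lemma no_fixpoint_mean_ergodic {R : realType} {p : {poly R}} (p1 : (1 < size p)%N) :
  (2 < size p)%N -> (forall x, p.[x] != x) ->
  mean_ergodic (X := schwartz R) (comp_op p1).
Proof.
move=> p2 nofix; exists (\0 : {linear schwartz R -> schwartz R}).
  exact: cst_continuous.
move=> f U /schwartz_nbhsP[n [e e0 HU]].
have [m [C C0 HC]] := seminorm_iter_decay p p1 n p2 nofix.
have s0 : 0 <= seminorm m f by exact/seminorm_ge0/schwartzP.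
exists (Num.truncn (C * seminorm m f / e)).+1 => // k /= Nk.
apply: HU; rewrite subr0; apply: (le_lt_trans (seminorm_natrVZ _ _ _)).
have k0 : 0 < k%:R :> R by rewrite ltr0n; case: k Nk.
rewrite mulrC ltr_pdivrMr// mulrC -ltr_pdivrMr//.
apply: (@le_lt_trans _ _ (C * seminorm m f / e)); last first.
  by apply: (lt_le_trans (truncnS_gt _)); rewrite ler_nat.
rewrite ler_wpM2r ?invr_ge0 ?(ltW e0)//; apply: (le_trans (seminorm_sum _ _ _)).
apply: (@le_trans _ _ (\sum_(1 <= i < k.+1) (C * seminorm m f) * 2^-1 ^+ i)).
  by apply: ler_sum => i _; apply: (le_trans (HC i f)); rewrite mulrAC.
by rewrite -mulr_sumr ler_piMr ?mulr_ge0// geometric_sum_le1.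
Qed.

(** The linear growth of one derivative at an expanding fixed point of p^h
contradicts the o(k) bound along the multiples of h. *)
Lemma sublinear_no_fixpoint {R : realType} {p : {poly R}} (p1 : (1 < size p)%N) :
  (2 < size p)%N -> sublinear_orbits (comp_op p1) ->
  ~~ odd (size p).-1 /\ (forall x, p.[x] != x).
Proof.
move=> p2 sub.
suff H : ~ (odd (size p).-1 \/ exists x, p.[x] = x).
  split; first by apply/negP => po; apply: H; left.
  by move=> x; apply/eqP => px; apply: H; right; exists x.
move=> /(expanding_fixpoint _ p2)[q [h [x [h0 qE qX qx q'x]]]].
have [j Hj] := jet_linear_growth q x qX qx q'x.
have [f f'x] := schwartz_nonzero_deriv x.
have [c c0 [M HM]] := Hj f (schwartzP f).1 f'x.
have hR : 0 < h%:R :> R by rewrite ltr0n.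
(* The slope c / (2 h) at time k h leaves half of the growth c k. *)
have [N HN] := sub j f (c / (2 * h%:R)) (divr_gt0 c0 (mulr_gt0 (ltr0Sn R 1) hR)).
have bound k : (N <= k)%N -> c * k%:R <= c / 2 * k%:R + M.
  move=> Nk; apply: (le_trans (HM k)); rewrite lerD2r.
  have Nkh : (N <= k * h)%N by rewrite (leq_trans Nk)// leq_pmulr.
  apply: le_trans (le_trans _ (HN _ Nkh)) _; last first.
    by rewrite natrM le_eqVlt; apply/orP; left; apply/eqP; field; rewrite gt_eqF.
  have -> : (fun y => (f : R -> R[i]) (iter k (horner q) y)) = iter (k * h) (comp_op p1) f.
    apply/funext => y; rewrite iter_comp_opE; congr (schwartz_val f _).
    by rewrite iterM; elim: k {Nk Nkh} => //= k ->; rewrite qE.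
  rewrite -[leLHS]mul1r -[X in X * _](expr0 (1 + `|x| ^+ 2)).
  exact: (le_seminorm x (schwartzP _) (leq0n j) (leqnn j)).
pose k := maxn N (Num.truncn (2 * M / c)).+1.
have := bound k (leq_maxl _ _).
have : 2 * M / c < k%:R.
  by apply: (lt_le_trans (truncnS_gt _)); rewrite ler_nat leq_maxr.
by rewrite ltr_pdivrMr// => ? ?; lra.
Qed.

Theorem theorem3p7 (R : realType) (p : {poly R}) (hp : (2 < size p)%N) :
  (power_bounded (X := schwartz R) (comp_op (ltnW hp)) <->
   mean_ergodic (X := schwartz R) (comp_op (ltnW hp))) /\
  (mean_ergodic (X := schwartz R) (comp_op (ltnW hp)) <->
   ~~ odd (size p).-1 /\ (forall x : R, p.[x] != x)).
Proof.
have me nofix := no_fixpoint_mean_ergodic (ltnW hp) hp nofix.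
have pb nofix := no_fixpoint_power_bounded (ltnW hp) hp nofix.
have sub := sublinear_no_fixpoint (ltnW hp) hp.
split; split.
- by move=> /power_bounded_sublinear/sub[_ /me].
- by move=> /mean_ergodic_sublinear/sub[_ /pb].
- by move=> /mean_ergodic_sublinear/sub.
- by move=> [_ /me].
Qed.
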